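(* Let $P=(P_0,\dots,P_{2n-1})$ be a CPPOS and $p\in\operatorname{int}(P)$, and suppose that a cell of the pencil through $p$ is supported on the adjacent sides $e_i$ and $e_{i+1}$. Let $T_i:\mathbb{R}^2\to\mathbb{R}^2$ be the unique affine map defined by $$T_i(P_{i+1}+re_i+se_{i+1})=P_{i+n+1}+re_{i+n}+se_{i+n+1}\qquad(r,s\in\mathbb{R}).$$ Then every reflected line belonging to this cell passes through $T_i(p)$. Consequently, the corresponding conic piece of $\operatorname{ART}_P(p)$ degenerates to the single point $T_i(p)$.
   Context: A CPPOS (convex polygon with parallel opposite sides) is a positively oriented convex polygon $P=(P_0,\dots,P_{2n-1})$, indices modulo $2n$, all $P_i$ genuine vertices (consecutive edge vectors linearly independent), whose edge vectors $e_i=P_{i+1}-P_i$ satisfy $e_{i+n}\parallel e_i$. $P$ also denotes the closed convex region it bounds. Boundary involution: $\sigma_P:\partial P\to\partial P$, $\sigma_P(P_i+s e_i)=P_{i+n}+s e_{i+n}$, $0\le s\le1$. For a line $\ell$ meeting $\operatorname{int}(P)$ with boundary intersection points $x_\ell,y_\ell$, the reflected line is $\Phi_P(\ell)=\overline{\sigma_P(x_\ell)\sigma_P(y_\ell)}$. $\Lambda_p$ is the pencil of lines through $p$. The cell supported on $e_i$ and $e_j$ is the open arc of lines of $\Lambda_p$ whose two boundary intersection points lie in the open sides $e_i=(P_i,P_{i+1})$ and $e_j=(P_j,P_{j+1})$. The piece of $\operatorname{ART}_P(p)$ (affine reflection transform) corresponding to a cell is the envelope of the reflected lines of that cell (with homogeneous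 line coordinates $\boldsymbol\ell(s)$, the envelope point is $[\boldsymbol\ell\times\boldsymbol\ell']$); it is always a conic arc or a degeneration of one. *)

(* Defs.v *)
From HB Require Import structures.
From mathcomp Require Import all_boot all_order all_algebra.
From mathcomp Require Import all_classical all_reals all_analysis.
Set Implicit Arguments.
Unset Strict Implicit.
Unset Printing Implicit Defensive.
Import Order.TTheory GRing.Theory Num.Theory.
Import numFieldNormedType.Exports.
Local Open Scope classical_set_scope.
Local Open Scope ring_scope.

Section Cppos.
Context {R : realType}.
Local Notation point := 'rV[R]_2.

Definition det2 (u v : point) : R := u 0 0 * v 0 1 - u 0 1 * v 0 0.

Definition line (a v : point) : set point := [set a + t *: v | t in [set: R]].

Definition line_through (a b : point) : set point := line a (b - a).

Definition pencil (p : point) : set (set point) :=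
  [set line p v | v in [set v | v != 0]].

Section Polygon.
Context {n : nat}.
Implicit Types (P : 'Z_(2 * n) -> point) (i j k : 'Z_(2 * n)).

Definition edge P i : point := P (i + 1) - P i.

(* The strict inequality says that every side lies on a supporting line of
   the polygon, traversed counterclockwise, which meets the vertex set only in
   the two ends of the side; in particular closed curves winding more than
   once around are excluded. Independence of consecutive edges only adds
   something for n <= 1, where it is false; hence n >= 2, and 'Z_(2 * n) is
   the ring of integers modulo 2n. *)
Record cppos P : Prop := Cppos {
  cppos_convex : forall i k, k != i -> k != i + 1 ->
    0 < det2 (edge P i) (P k - P i);
  cppos_vertex : forall i, free [:: edge P i; edge P (i + 1)];
  cppos_parallel : forall i, edge P (i + n%:R) \in <[edge P i]>%VS }.

Definition region P : set point :=
  smallest (@convex_set R point) (range P).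

Definition boundary P : set point :=
  [set x | exists i, exists s : R, 0 <= s <= 1 /\ x = P i + s *: edge P i].

Definition open_side P i : set point :=
  [set P i + s *: edge P i | s in [set s : R | 0 < s < 1]].

(* The point chosen by xget is unique when x lies on the boundary of a CPPOS;
   off the boundary sigma is the identity, an irrelevant default. *)
Definition sigma P (x : point) : point :=
  xget x [set y | exists i, exists s : R, [/\ 0 <= s <= 1,
    x = P i + s *: edge P i & y = P (i + n%:R) + s *: edge P (i + n%:R)]].

(* If L meets the interior of P, then {x, y} is determined by L, so that the
   union below is a single line. *)
Definition reflected_line P (L : set point) : set point :=
  [set z | exists x y, [/\ x != y, L `&` boundary P = [set x; y]
                         & line_through (sigma P x) (sigma P y) z]].

Definition cell P (p : point) i j : set (set point) :=
  [set L | pencil p L /\ exists x y,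
    [/\ L `&` boundary P = [set x; y], open_side P i x & open_side P j y]].

Definition hom (x : point) : 'rV[R]_3 := row_mx x (1%:M : 'M[R]_1).

Definition proj_point (x : point) : {vspace 'rV[R]_3} := <[hom x]>%VS.

Definition line_coords (L : set point) (l : 'rV[R]_3) : Prop :=
  l != 0 /\ L = [set x | l *m (hom x)^T = 0].

(* Indices are added modulo 3. *)
Definition cross (u v : 'rV[R]_3) : 'rV[R]_3 :=
  \row_k (u 0 (k + 1) * v 0 (k + 2) - u 0 (k + 2) * v 0 (k + 1)).

(* A piece is a set of points of the real projective plane, these being
   encoded as lines of R^3 (so that a vanishing cross product yields not a point
   but the zero subspace). The pencil is parametrized near s by any direction
   field v which is regular at s, and l is any differentiable choice of
   homogeneous coordinates of the reflected lines: the envelope point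
   [cross l l'] does not depend on these choices. *)
Definition ART_piece P (p : point) i j : set {vspace 'rV[R]_3} :=
  [set q | exists (v : R -> point) (l : R -> 'rV[R]_3) (s : R),
    [/\ derivable v s 1 /\ free [:: v s; derive1 v s],
        derivable l s 1,
        \forall t \near s, cell P p i j (line p (v t)) /\
          line_coords (reflected_line P (line p (v t))) (l t)
      & q = <[cross (l s) (derive1 l s)]>%VS]].

Definition affine_map (T : point -> point) : Prop :=
  exists (A : 'M[R]_2) (b : point), forall x, T x = x *m A + b.

Definition corner_map P i (T : point -> point) : Prop :=
  affine_map T /\ forall r s : R,
    T (P (i + 1) + r *: edge P i + s *: edge P (i + 1)) =
    P (i + n%:R + 1) + r *: edge P (i + n%:R) + s *: edge P (i + n%:R + 1).

End Polygon.
End Cppos.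

(* Main.v *)
Require Import Defs.
From mathcomp Require Import all_boot all_order all_algebra.
From mathcomp Require Import all_classical all_reals all_analysis.
From mathcomp Require Import ring.
Set Implicit Arguments.
Unset Strict Implicit.
Unset Printing Implicit Defensive.
Import Order.TTheory GRing.Theory Num.Theory.
Import numFieldNormedType.Exports.
Local Open Scope classical_set_scope.
Local Open Scope ring_scope.

(** Let e and f be the sides [edge P i] and [edge P (i + 1)], which meet at
the vertex P_(i+1). On an open side, [sigma P] is affine in the side parameter,
and it sends the open sides e and f to the two opposite sides exactly as the
corner map T does, since T sends the frame (P_(i+1); e, f) to the frame formed
by the opposite vertex and the opposite sides ([corner_map_side]). A line of the
cell meets the boundary in one point x of e and one point y of f, so its
reflected line joins T x to T y: it is the image under T of the line through x
and y, and it passes through T p because p lies on that line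
([reflected_line_cell]).

For the piece itself, let A be the linear part of T and let v(s) be the
direction of the moving line of the pencil. The reflected line goes through
q = T p in direction w = v A. Its coordinates l satisfy l . (q, 1) = 0 and
l . (w, 0) = 0; differentiating the first identity gives l' . (q, 1) = 0, so
l x l' is a multiple d of (q, 1), and differentiating the second identity shows
that d is a nonzero multiple of det(w, w'), which in turn is a nonzero multiple
of det(v, v') as A is invertible ([cross_line_coords]). Hence every envelope
point is T p. That the piece is not empty comes from the cell being open in the
pencil ([cell_open]): a line of the cell crosses its two sides transversally,
and in a strictly convex polygon a line through two different open sides meets
the boundary nowhere else ([secant_boundary]). So a line of the cell can be
rotated slightly about p within the cell. *)

(** * Determinants and lines in the plane *)

Section Plane.
Context {R : realType}.
Implicit Types (u v w x y z p q a b : 'rV[R]_2) (A : 'M[R]_2) (l : 'rV[R]_3).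

Lemma rV2P u v : u 0 0 = v 0 0 -> u 0 1 = v 0 1 -> u = v.
Proof.
move=> h0 h1; apply/rowP => j.
case: (unliftP 0 j) => [k|] ->; rewrite ?ord1 // (_ : lift _ _ = 1) //.
exact/val_inj.
Qed.

Lemma det2C u v : det2 v u = - det2 u v.
Proof. by rewrite /det2; ring. Qed.

Lemma det2uu u : det2 u u = 0.
Proof. by rewrite /det2; ring. Qed.

Lemma det2v0 u : det2 u 0 = 0.
Proof. by rewrite /det2 !mxE; ring. Qed.

Lemma det2D u v w : det2 u (v + w) = det2 u v + det2 u w.
Proof. by rewrite /det2 !mxE; ring. Qed.

Lemma det2B u v w : det2 u (v - w) = det2 u v - det2 u w.
Proof. by rewrite /det2 !mxE; ring. Qed.

Lemma det2Z u (c : R) v : det2 u (c *: v) = c * det2 u v.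
Proof. by rewrite /det2 !mxE; ring. Qed.

Lemma det2_cramer u v x : det2 u v *: x = det2 x v *: u + det2 u x *: v.
Proof. by apply: rV2P; rewrite /det2 !mxE; ring. Qed.

Lemma mulmx2E u A j : (u *m A) 0 j = u 0 0 * A 0 j + u 0 1 * A 1 j.
Proof.
rewrite !mxE !big_ord_recl big_ord0 addr0.
by rewrite (_ : lift _ _ = 1) //; exact/val_inj.
Qed.

Lemma det2_mulmx u v A :
  det2 (u *m A) (v *m A) = det2 (row 0 A) (row 1 A) * det2 u v.
Proof. by rewrite /det2 !mulmx2E !mxE; ring. Qed.

Definition rot90 u : 'rV[R]_2 := \row_j (if j == 0 then - u 0 1 else u 0 0).

Lemma det2_rot90_gt0 u : u != 0 -> 0 < det2 u (rot90 u).
Proof.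
move=> u0; rewrite /det2 /rot90 !mxE /=.
have -> : u 0 0 * u 0 0 - u 0 1 * - u 0 1 = u 0 0 ^+ 2 + u 0 1 ^+ 2 by ring.
rewrite lt0r addr_ge0 ?sqr_ge0 // andbT paddr_eq0 ?sqr_ge0 // !sqrf_eq0.
by apply: contra u0 => /andP[/eqP h0 /eqP h1]; apply/eqP/rV2P; rewrite mxE.
Qed.

Lemma det2_eq0 u v : u != 0 -> det2 u v = 0 -> exists c : R, v = c *: u.
Proof.
move=> /det2_rot90_gt0/lt0r_neq0 D uv.
exists ((det2 u (rot90 u))^-1 * det2 v (rot90 u)).
have := det2_cramer u (rot90 u) v; rewrite uv scale0r addr0 => h.
by rewrite -scalerA -h scalerA mulVf // scale1r.
Qed.

Lemma free_det2 u v : free [:: u; v] = (det2 u v != 0).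
Proof.
rewrite free_cons seq1_free span_seq1.
have [->|v0] := eqVneq v 0.
  by rewrite andbF det2v0 eqxx.
rewrite andbT; congr negb; apply/vlineP/eqP => [[c ->]|].
  by rewrite det2C det2Z det2uu mulr0 oppr0.
by move=> uv; apply: det2_eq0; rewrite // det2C uv oppr0.
Qed.

Lemma det2_neq0l u v : det2 u v != 0 -> u != 0.
Proof. by apply: contraNneq => ->; rewrite det2C det2v0 oppr0. Qed.

Lemma det2_neq0r u v : det2 u v != 0 -> v != 0.
Proof. by apply: contraNneq => ->; rewrite det2v0. Qed.

Lemma lineP q w z : line q w z <-> exists t : R, z = q + t *: w.
Proof. by split=> [[t _ <-]|[t ->]]; exists t. Qed.

Lemma det2_line w q (t : R) : det2 w (q + t *: w - q) = 0.
Proof. by rewrite addrAC subrr add0r det2Z det2uu mulr0. Qed.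

Lemma line_det2 q w z : w != 0 -> line q w z <-> det2 w (z - q) = 0.
Proof.
move=> w0; split=> [[t _ <-]|/(det2_eq0 w0)[t zq]].
  exact: det2_line.
by exists t => //; rewrite -zq addrC subrK.
Qed.

Lemma line_throughE q w (a b : R) : a != b ->
  line_through (q + a *: w) (q + b *: w) = line q w.
Proof.
move=> ab; have ba0 : b - a != 0 by rewrite subr_eq0 eq_sym.
rewrite eqEsubset /line_through /line; split=> _ [t _ <-] /=.
  by exists (a + t * (b - a)) => //; apply/rowP => j; rewrite !mxE; ring.
by exists ((t - a) / (b - a)) => //; apply/rowP => j; rewrite !mxE; field.
Qed.

Lemma linear_interpolation e f e' f' : det2 e f != 0 ->
  exists A : 'M[R]_2, e *m A = e' /\ f *m A = f'.
Proof.
(* Cramer's rule: the coordinates of x in the basis (e, f) are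
   det2 x f = - (x . rot90 f) and det2 e x = x . rot90 e, over det2 e f. *)
move=> D0; exists (\matrix_(j, k) ((det2 e f)^-1 *
  (rot90 e 0 j * f' 0 k - rot90 f 0 j * e' 0 k))).
by split; apply: rV2P; rewrite mulmx2E !mxE /= /det2; field.
Qed.

End Plane.

(** * Calculus along one real parameter *)

Section Calculus.
Context {R : realType}.

Lemma near_mul_affine_gt0 (a b a' b' : R) : 0 < a * b ->
  \forall t \near (0 : R), 0 < (a + t * a') * (b + t * b').
Proof.
move=> ab; have : (a + t * a') * (b + t * b') @[t --> (0 : R)] -->
    (a + 0 * a') * (b + 0 * b').
  by apply: cvgM; apply: cvgD; try exact: cvg_cst;
     apply: cvgMr_tmp; exact: cvg_id.
by rewrite !mul0r !addr0 => /cvgr_gt; apply.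
Qed.

Lemma is_derive_mul2 (f g h k : R -> R) (s df dg dh dk : R) :
  is_derive s 1 f df -> is_derive s 1 g dg ->
  is_derive s 1 h dh -> is_derive s 1 k dk ->
  is_derive s 1 (fun t => f t * g t + h t * k t)
    (df * g s + f s * dg + (dh * k s + h s * dk)).
Proof.
move=> Hf Hg Hh Hk; have H := is_deriveD (is_deriveM Hf Hg) (is_deriveM Hh Hk).
apply: is_derive_eq H _; rewrite /GRing.scale /=.
rewrite ![_ * df]mulrC ![_ * dh]mulrC.
by rewrite ![_ + _ * g s]addrC ![_ + _ * k s]addrC.
Qed.

Lemma is_derive_coord m (u : R -> 'rV[R]_m) (s : R) k : derivable u s 1 ->
  is_derive s 1 (fun t => u t 0 k) (derive1 u s 0 k).
Proof.
move=> us; apply: DeriveDef; first by move/derivable_mxP: us; exact.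
by rewrite derive1E derive_mx // mxE.
Qed.

Lemma is_derive_affine m (a u : 'rV[R]_m) (s : R) :
  is_derive s 1 (fun t : R => a + t *: u) u.
Proof.
have comp i j : is_derive s 1 (fun t : R => (a + t *: u) i j) (u i j).
  rewrite (_ : (fun _ => _) = fun t => a i j * 1 + t * u i j).
    have H := is_derive_mul2
      (is_derive_cst (a i j) s 1) (is_derive_cst (1 : R) s 1)
      (is_derive_id s 1) (is_derive_cst (u i j) s 1).
    by apply: is_derive_eq H _; rewrite /cst mul0r !mulr0 mul1r !addr0 add0r.
  by apply/funext => t; rewrite !mxE mulr1.
have dv : derivable (fun t : R => a + t *: u) s 1 by apply/derivable_mxP.
apply: DeriveDef => //; rewrite derive_mx //.
by apply/matrixP => i j; rewrite mxE derive_val.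
Qed.

Lemma near0_derive (f : R -> R) (s df : R) :
  is_derive s 1 f df -> (\forall t \near s, f t = 0) -> df = 0.
Proof.
move=> [_ <-] f0; rewrite -(derive_cst (0 : R) s (1 : R)).
exact: near_eq_derive.
Qed.

End Calculus.

(** * Secants of a convex polygon *)

Section Polygon.
Context {R : realType} {n : nat}.
Context (P : 'Z_(2 * n) -> 'rV[R]_2) (HP : cppos P).
Implicit Types (i j k : 'Z_(2 * n)) (p v x y z : 'rV[R]_2).

Lemma det2_edge_neq0 i : det2 (edge P i) (edge P (i + 1)) != 0.
Proof. by rewrite -free_det2 cppos_vertex. Qed.

Lemma succ_neq i : i + 1 != i.
Proof. by rewrite -[X in _ != X]addr0 (inj_eq (addrI i)) oner_neq0. Qed.

(** Were there only two indices, consecutive edges would be opposite. *)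
Lemma succ2_neq i : i + 1 + 1 != i.
Proof.
apply: contraNneq (det2_edge_neq0 i) => ii.
by rewrite {2}/edge ii -opprB -/(edge P i) -scaleN1r det2Z det2uu mulr0.
Qed.

Lemma det2_side j i (s : R) (e := edge P j) :
  det2 e (P i + s *: edge P i - P j) =
  (1 - s) * det2 e (P i - P j) + s * det2 e (P (i + 1) - P j).
Proof. by rewrite /det2 /edge !mxE; ring. Qed.

Lemma det2_edge_ge0 j k : 0 <= det2 (edge P j) (P k - P j).
Proof.
have [->|kj] := eqVneq k j; first by rewrite subrr det2v0.
have [->|kj1] := eqVneq k (j + 1); first by rewrite -/(edge P j) det2uu.
exact/ltW/cppos_convex.
Qed.

Lemma boundary_ge0 j z : boundary P z -> 0 <= det2 (edge P j) (z - P j).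
Proof.
move=> [i [s [/andP[s0 s1] ->]]]; rewrite det2_side.
by rewrite addr_ge0 ?mulr_ge0 ?det2_edge_ge0 // subr_ge0.
Qed.

(** An open side other than the j-th has at least one end off the line that
supports the j-th side, and its points give that end a positive weight. *)
Lemma open_side_gt0 i j x :
  open_side P i x -> j != i -> 0 < det2 (edge P j) (x - P j).
Proof.
move=> [s /= /andP[s0 s1] <-] ji; rewrite det2_side.
have [ij|ij] := eqVneq i (j + 1).
  apply: ltr_wpDl; first by rewrite mulr_ge0 ?det2_edge_ge0 // subr_ge0 ltW.
  rewrite mulr_gt0 //; apply: (cppos_convex HP) => //; rewrite ij ?succ2_neq //.
  exact: succ_neq.
apply: ltr_pwDl; last by rewrite mulr_ge0 ?det2_edge_ge0 // ltW.
rewrite mulr_gt0 //; first by rewrite subr_gt0.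
by apply: (cppos_convex HP); rewrite // eq_sym.
Qed.

(** A point of an open side lies on no other closed side: this makes the point
chosen by [sigma] unambiguous, and different open sides disjoint. *)
Lemma open_side_inj i j x (s : R) :
  open_side P i x -> x = P j + s *: edge P j -> j = i.
Proof.
move=> xi xE; apply/eqP; apply: contraT => /(open_side_gt0 xi).
by rewrite xE det2_line ltxx.
Qed.

Lemma open_side_boundary i x : open_side P i x -> boundary P x.
Proof.
by move=> [s /= /andP[s0 s1] <-]; exists i, s; rewrite !ltW.
Qed.

Lemma sigma_open_side i (s : R) : 0 < s < 1 ->
  sigma P (P i + s *: edge P i) = P (i + n%:R) + s *: edge P (i + n%:R).
Proof.
move=> s01; have xi : open_side P i (P i + s *: edge P i) by exists s.
case/andP: (s01) => /ltW s0 /ltW s1.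
apply: xget_unique => [|y [j [t [_ xE ->]]]]; first by exists i, s; rewrite s0.
have ji := open_side_inj xi xE; move: xE; rewrite ji => /addrI/eqP.
rewrite -subr_eq0 -scalerBl scaler_eq0 (negbTE (det2_neq0l (det2_edge_neq0 i))).
by rewrite orbF subr_eq0 => /eqP ->.
Qed.

(** The supporting half-planes of the i-th and j-th sides confine the boundary
points of the secant to the segment [x, y]. A point strictly inside this
segment could lie on a side k only if x and y both lay on the supporting line
of that side, which would force k = i and k = j. *)
Lemma secant_boundary i j p v (a b : R) : i != j ->
  open_side P i (p + a *: v) -> open_side P j (p + b *: v) ->
  line p v `&` boundary P = [set p + a *: v; p + b *: v].
Proof.
move=> ij xi yj; set x := p + a *: v; set y := p + b *: v.
have ab : a != b.
  apply: contraNneq ij => ab; have [s _ xE] := xi.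
  by apply/eqP/(@open_side_inj j i x s); rewrite ?xE // /x ab.
have xB := open_side_boundary xi; have yB := open_side_boundary yj.
rewrite eqEsubset; split=> [z [[t _ zE] zB]|z [] ->]; last 2 first.
- by split=> //; exists a.
- by split=> //; exists b.
have ba0 : b - a != 0 by rewrite subr_eq0 eq_sym.
(* c is the barycentric coordinate of z with respect to x and y. *)
have [c tE] : exists c, t = a + c * (b - a).
  by exists ((t - a) / (b - a)); rewrite divfK // addrC subrK.
have zc k : det2 (edge P k) (z - P k) =
    (1 - c) * det2 (edge P k) (x - P k) + c * det2 (edge P k) (y - P k).
  by rewrite -zE tE /x /y /det2 !mxE; ring.
have side0 k w : open_side P k w -> det2 (edge P k) (w - P k) = 0.
  by move=> [s _ <-]; exact: det2_line.
have c0 : 0 <= c.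
  have := boundary_ge0 i zB; rewrite zc (side0 _ _ xi) mulr0 add0r.
  by rewrite pmulr_lge0 // (open_side_gt0 yj).
have c1 : 0 <= 1 - c.
  have := boundary_ge0 j zB; rewrite zc (side0 _ _ yj) mulr0 addr0.
  by rewrite pmulr_lge0 // (open_side_gt0 xi) // eq_sym.
have [k [s [_ zk]]] := zB.
have zk0 : det2 (edge P k) (z - P k) = 0 by rewrite zk det2_line.
move: zk0; rewrite zc => /eqP; rewrite paddr_eq0; last 2 first.
- by rewrite mulr_ge0 // boundary_ge0.
- by rewrite mulr_ge0 // boundary_ge0.
rewrite !mulf_eq0 -zE subr_eq0 => /andP[xk yk].
case/orP: xk => [/eqP c1E|/eqP xk].
  by right; rewrite /= /y tE -c1E mul1r (addrC a) subrK.
have ki : k = i.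
  by apply/eqP; apply: contraT => /(open_side_gt0 xi); rewrite xk ltxx.
case/orP: yk => [/eqP c0E|/eqP yk]; first by left; rewrite tE c0E mul0r addr0.
have : k != j by rewrite ki.
by move=> /(open_side_gt0 yj); rewrite yk ltxx.
Qed.

(** As secants meet the boundary in two points only, belonging to the cell is a
condition on each of the two sides separately, stable under small rotations. *)
Lemma cell_lineP i j p v : i != j ->
  cell P p i j (line p v) <->
  (exists a : R, open_side P i (p + a *: v)) /\
  (exists b : R, open_side P j (p + b *: v)).
Proof.
move=> ij; split=> [[_ [x [y [Lxy xi yj]]]]|[[a xi] [b yj]]].
  have [/lineP[a xE] _] : (line p v `&` boundary P) x by rewrite Lxy; left.
  have [/lineP[b yE] _] : (line p v `&` boundary P) y by rewrite Lxy; right.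
  by split; [exists a; rewrite -xE|exists b; rewrite -yE].
split; last first.
  exists (p + a *: v), (p + b *: v); split=> //.
  exact: secant_boundary ij xi yj.
exists v => //=; apply: contraNneq ij => v0.
have [s _ xE] := xi; apply/eqP/(@open_side_inj j i (p + a *: v) s) => //.
by move: yj; rewrite v0 !scaler0.
Qed.

(** A secant parallel to the side that it crosses would be contained in the line
supporting that side, hence would miss every other open side. *)
Lemma secant_transversal i j p v (a b : R) : i != j ->
  open_side P i (p + a *: v) -> open_side P j (p + b *: v) ->
  det2 v (edge P i) != 0.
Proof.
move=> ij [s _ xE] /open_side_gt0 /(_ ij).
have -> : p + b *: v - P i = s *: edge P i + (b - a) *: v.
  rewrite -(addKr (P i) (s *: _)) xE scalerBl.
  by apply/rowP=> k; rewrite !mxE; ring.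
rewrite det2D !det2Z det2uu mulr0 add0r (det2C v) => h.
apply: contraTneq h => ->.
by rewrite oppr0 mulr0 ltxx.
Qed.

(** The line through p meets the line supporting side i at parameter N / D, where
N = det2 v (p - P i) and D = det2 v (edge P i). The two inequalities say that
0 < N / D < 1, cleared of denominators so that each is an open polynomial
condition on v. *)
Lemma open_side_meet i p v : det2 v (edge P i) != 0 ->
  (exists a : R, open_side P i (p + a *: v)) <->
  0 < det2 v (p - P i) * det2 v (edge P i) /\
  0 < det2 v (P (i + 1) - p) * det2 v (edge P i).
Proof.
move=> D0; have D2 : 0 < det2 v (edge P i) * det2 v (edge P i).
  by rewrite -expr2 exprn_even_gt0.
split=> [[a [s /= /andP[s0 s1] xE]]|[N0 N1]].
  have h : det2 v (p - P i) = s * det2 v (edge P i).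
    rewrite -det2Z; have -> : p - P i = s *: edge P i - a *: v.
      by rewrite -(addKr (P i) (s *: _)) xE; apply/rowP=> k; rewrite !mxE; ring.
    by rewrite det2B (det2Z _ a) det2uu mulr0 subr0.
  have h' : det2 v (P (i + 1) - p) = (1 - s) * det2 v (edge P i).
    have -> : P (i + 1) - p = edge P i - (p - P i).
      by rewrite /edge; apply/rowP=> k; rewrite !mxE; ring.
    by rewrite det2B h mulrBl mul1r.
  by rewrite h h' -!mulrA; split; rewrite mulr_gt0 // subr_gt0.
pose s := det2 v (p - P i) / det2 v (edge P i).
have /lineP[a aE] : line p v (P i + s *: edge P i).
  apply/line_det2; first exact: det2_neq0l D0.
  have -> : P i + s *: edge P i - p = s *: edge P i - (p - P i).
    by apply/rowP=> k; rewrite !mxE; ring.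
  by rewrite det2B det2Z divfK ?subrr.
exists a; rewrite -aE; exists s => //=.
have sE : s = det2 v (p - P i) * det2 v (edge P i) /
    (det2 v (edge P i) * det2 v (edge P i)).
  by rewrite /s; field.
have s1E : 1 - s = det2 v (P (i + 1) - p) * det2 v (edge P i) /
    (det2 v (edge P i) * det2 v (edge P i)).
  have -> : P (i + 1) - p = edge P i - (p - P i).
    by rewrite /edge; apply/rowP=> k; rewrite !mxE; ring.
  by rewrite det2B /s; field.
by rewrite sE divr_gt0 //= -sE -subr_gt0 s1E divr_gt0.
Qed.

Lemma secant_open i j p v w (a b : R) : i != j ->
  open_side P i (p + a *: v) -> open_side P j (p + b *: v) ->
  \forall t \near (0 : R), exists c : R, open_side P i (p + c *: (v + t *: w)).
Proof.
move=> ij xi yj; have D0 := secant_transversal ij xi yj.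
have [|N0 N1] := (open_side_meet p D0).1; first by exists a.
have det2Dl (t : R) u : det2 (v + t *: w) u = det2 v u + t * det2 w u.
  by rewrite /det2 !mxE; ring.
have near_gt0 u u' : 0 < det2 v u * det2 v u' ->
    \forall t \near (0 : R), 0 < det2 (v + t *: w) u * det2 (v + t *: w) u'.
  move=> /(near_mul_affine_gt0 (det2 w u) (det2 w u')).
  by apply: filterS => t; rewrite !det2Dl.
have D2 : 0 < det2 v (edge P i) * det2 v (edge P i).
  by rewrite -expr2 exprn_even_gt0.
apply: filterS3 (near_gt0 _ _ D2) (near_gt0 _ _ N0) (near_gt0 _ _ N1).
move=> t Dt Nt0 Nt1; apply/open_side_meet => //.
by apply: contraTneq Dt => ->; rewrite mul0r ltxx.
Qed.

Lemma cell_open i j p v w : i != j -> cell P p i j (line p v) ->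
  \forall t \near (0 : R), cell P p i j (line p (v + t *: w)).
Proof.
move=> ij /(cell_lineP _ _ ij)[[a xi] [b yj]].
near=> t; apply/cell_lineP => //; split; near: t.
  exact: secant_open xi yj.
by apply: secant_open yj xi; rewrite eq_sym.
Unshelve. all: by end_near. Qed.

(** * The corner map *)

Lemma corner_map_exists_unique i : exists! T, corner_map P i T.
Proof.
have D0 := det2_edge_neq0 i.
have [A [eA fA]] := linear_interpolation
  (edge P (i + n%:R)) (edge P (i + n%:R + 1)) D0.
exists (fun x => x *m A + (P (i + n%:R + 1) - P (i + 1) *m A)); split.
  split; first by exists A, (P (i + n%:R + 1) - P (i + 1) *m A).
  move: eA fA; move: (edge P i) (edge P (i + 1)) => e f eA fA r s.
  rewrite 2!mulmxDl -!scalemxAl eA fA; move: (P (i + 1) *m A) => q.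
  by apply/rowP=> k; rewrite !mxE; ring.
move=> T' [_ cT']; apply/funext => x.
move: eA fA D0 cT'; move: (edge P i) (edge P (i + 1)) => e f eA fA D0 cT'.
have -> : x = P (i + 1) + (det2 (x - P (i + 1)) f / det2 e f) *: e +
    (det2 e (x - P (i + 1)) / det2 e f) *: f.
  by apply: rV2P; rewrite !mxE /det2 !mxE; field.
rewrite cT' 2!mulmxDl -!scalemxAl eA fA; move: (P (i + 1) *m A) => q.
by apply/rowP=> k; rewrite !mxE; ring.
Qed.

Lemma corner_map_edge i T A b : corner_map P i T ->
  (forall x, T x = x *m A + b) ->
  edge P i *m A = edge P (i + n%:R) /\
  edge P (i + 1) *m A = edge P (i + 1 + n%:R).
Proof.
move=> [_ cT] TE; rewrite [i + 1 + n%:R]addrAC; move: cT.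
move: (edge P i) (edge P (i + 1)) (edge P (i + n%:R)) (edge P (i + n%:R + 1)).
move=> e f e' f' cT.
have h (r s : R) : r *: (e *m A) + s *: (f *m A) = r *: e' + s *: f'.
  have := cT r s; have := cT 0 0.
  rewrite !TE !mulmxDl -!scalemxAl !scale0r !addr0.
  move=> <- h; apply: (addrI (P (i + 1) *m A + b)).
  by rewrite !addrA -h !(addrAC _ b).
by have := h 1 0; have := h 0 1; rewrite !scale1r !scale0r !addr0 !add0r.
Qed.

(** T carries two independent edges to two independent edges. *)
Lemma corner_map_det_neq0 i T (A : 'M[R]_2) b : corner_map P i T ->
  (forall x, T x = x *m A + b) -> det2 (row 0 A) (row 1 A) != 0.
Proof.
move=> cT TE; have [eA fA] := corner_map_edge cT TE.
have := det2_edge_neq0 (i + n%:R); rewrite -addrAC -eA -fA det2_mulmx.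
by apply: contraNneq => ->; rewrite mul0r.
Qed.

Lemma corner_map_side i T x : corner_map P i T ->
  open_side P i x \/ open_side P (i + 1) x -> sigma P x = T x.
Proof.
move=> [_ cT] [] [s s01 <-]; rewrite sigma_open_side //.
  (* The parameter s runs from P i, whereas T is given in a frame at P (i + 1). *)
  have := cT (s - 1) 0; rewrite !scale0r !addr0 !scalerBl !scale1r.
  rewrite [RHS](_ : _ = P (i + n%:R) + s *: edge P (i + n%:R)) => [<-|].
    congr T; rewrite /edge; apply/rowP=> k; rewrite !mxE; ring.
  rewrite /edge; apply/rowP=> k; rewrite !mxE; ring.
by have := cT 0 s; rewrite !scale0r !addr0 [i + n%:R + 1]addrAC => ->.
Qed.

(** The two boundary points of the line are reflected by one and the same affine
map T, so the reflected line is the image of the line under T. *)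
Lemma reflected_line_cell i p v T A b : corner_map P i T ->
  (forall x, T x = x *m A + b) -> cell P p i (i + 1) (line p v) ->
  reflected_line P (line p v) = line (T p) (v *m A).
Proof.
move=> cT TE cv; have [_ [x0 [y0 [L0 x0i y0i]]]] := cv.
have sT x : (line p v `&` boundary P) x -> sigma P x = T x.
  by rewrite L0 => -[] ->; apply: (corner_map_side cT); [left|right].
have thrE x y : x != y -> (line p v `&` boundary P) x ->
    (line p v `&` boundary P) y ->
    line_through (sigma P x) (sigma P y) = line (T p) (v *m A).
  move=> xy xL yL; rewrite !sT //; have [/lineP[a' xE] _] := xL.
  have [/lineP[b' yE] _] := yL.
  have TD (c : R) : T (p + c *: v) = T p + c *: (v *m A).
    by rewrite !TE mulmxDl scalemxAl addrAC.
  rewrite xE yE !TD line_throughE //.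
  by apply: contraNneq xy => ab; rewrite xE yE ab.
rewrite eqEsubset; split=> z.
  move=> [x [y [xy Lxy]]]; rewrite thrE //; rewrite Lxy; [by left|by right].
move=> zT; exists x0, y0.
have xy0 : x0 != y0.
  apply: contraNneq (succ_neq i) => xy; have [s _ xE] := x0i.
  by apply/eqP/esym/(@open_side_inj (i + 1) i y0 s) => //; rewrite -xy xE.
split=> //; rewrite thrE // L0; [by left|by right].
Qed.
End Polygon.

(** * Line coordinates and the envelope of a pencil *)

Section Envelope.
Context {R : realType}.
Implicit Types (w q z : 'rV[R]_2) (l : 'rV[R]_3).

Lemma rV3P (l m : 'rV[R]_3) :
  l 0 0 = m 0 0 -> l 0 1 = m 0 1 -> l 0 2 = m 0 2 -> l = m.
Proof.
move=> h0 h1 h2; apply/rowP => -[[|[|[|k]]] hk] //.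
- by rewrite (_ : Ordinal hk = 0) //; apply/val_inj.
- by rewrite (_ : Ordinal hk = 1) //; apply/val_inj.
- by rewrite (_ : Ordinal hk = 2) //; apply/val_inj.
Qed.

Lemma row_mx3E w (c : 'rV[R]_1) (r := row_mx w c : 'rV[R]_3) :
  [/\ r 0 0 = w 0 0, r 0 1 = w 0 1 & r 0 2 = c 0 0].
Proof.
split.
- by rewrite -[RHS](row_mxEl w c); congr (_ _ _); exact: val_inj.
- by rewrite -[RHS](row_mxEl w c); congr (_ _ _); exact: val_inj.
- by rewrite -[RHS](row_mxEr w c); congr (_ _ _); exact: val_inj.
Qed.

Lemma homE z :
  [/\ Defs.hom z 0 0 = z 0 0, Defs.hom z 0 1 = z 0 1 & Defs.hom z 0 2 = 1].
Proof. by have [h0 h1 h2] := row_mx3E z 1%:M; split; rewrite // h2 mxE. Qed.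

Lemma incidenceE l z :
  l *m (Defs.hom z)^T = 0 <-> l 0 0 * z 0 0 + l 0 1 * z 0 1 + l 0 2 = 0.
Proof.
have [h0 h1 h2] := homE z.
have E : (l *m (Defs.hom z)^T) 0 0 = l 0 0 * z 0 0 + l 0 1 * z 0 1 + l 0 2.
  rewrite -h0 -h1 -[l 0 2]mulr1 -h2 mxE !big_ord_recl big_ord0 addr0 !mxE addrA.
  rewrite (_ : lift 0 (lift 0 0) = 2); last exact/val_inj.
  by rewrite (_ : lift 0 0 = 1); last exact/val_inj.
split=> [lz|lz]; first by rewrite -E lz mxE.
by apply/matrixP => a b; rewrite !ord1 E lz mxE.
Qed.

(** Coordinates of the line through q in direction w: the join of q with the
point at infinity (w, 0). *)
Definition join_coords q w : 'rV[R]_3 := cross (Defs.hom q) (row_mx w 0).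

Lemma crossE (l m : 'rV[R]_3) :
  [/\ cross l m 0 0 = l 0 1 * m 0 2 - l 0 2 * m 0 1,
      cross l m 0 1 = l 0 2 * m 0 0 - l 0 0 * m 0 2 &
      cross l m 0 2 = l 0 0 * m 0 1 - l 0 1 * m 0 0].
Proof.
have e11 : (1 + 1 : 'I_3) = 2 by exact/val_inj.
have e12 : (1 + 2 : 'I_3) = 0 by exact/val_inj.
have e21 : (2 + 1 : 'I_3) = 0 by exact/val_inj.
have e22 : (2 + 2 : 'I_3) = 1 by exact/val_inj.
by split; rewrite mxE ?add0r ?e11 ?e12 ?e21 ?e22.
Qed.

Lemma join_coordsE q w : [/\ join_coords q w 0 0 = - w 0 1,
  join_coords q w 0 1 = w 0 0 & join_coords q w 0 2 = - det2 w q].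
Proof.
have [w0 w1 w2] := row_mx3E w 0; have [h0 h1 h2] := homE q.
have [c0 c1 c2] := crossE (Defs.hom q) (row_mx w 0).
by rewrite /join_coords c0 c1 c2 h0 h1 h2 w0 w1 w2 mxE /det2; split; ring.
Qed.

Lemma join_coords_affine q w w' (t : R) :
  join_coords q (w + t *: w') = join_coords q w + t *: join_coords q w'.
Proof.
have [j0 j1 j2] := join_coordsE q w; have [j0' j1' j2'] := join_coordsE q w'.
have [k0 k1 k2] := join_coordsE q (w + t *: w').
have jZ k : (join_coords q w + t *: join_coords q w') 0 k =
  join_coords q w 0 k + t * join_coords q w' 0 k by rewrite mxE [X in _ + X]mxE.
apply: rV3P; rewrite jZ ?(j0, j0', k0) ?(j1, j1', k1) ?(j2, j2', k2) /det2 !mxE.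
all: by ring.
Qed.

(** The incidences with q and with the point at infinity (w, 0) of the line: along
a moving line, these are the two identities to differentiate. *)
Lemma line_coords_incident q w l : line_coords (line q w) l ->
  l 0 0 * q 0 0 + l 0 1 * q 0 1 + l 0 2 = 0 /\
  l 0 0 * w 0 0 + l 0 1 * w 0 1 = 0.
Proof.
move=> [_ lE].
have inc z : line q w z -> l 0 0 * z 0 0 + l 0 1 * z 0 1 + l 0 2 = 0.
  by rewrite lE => /incidenceE.
have q0 := inc q (ex_intro2 _ _ 0 I (etrans (congr1 _ (scale0r w)) (addr0 q))).
have := inc (q + 1 *: w) (ex_intro2 _ _ 1 I erefl); rewrite !mxE !mul1r => q1.
by split=> //; rewrite -[RHS](subrr 0) -{1}q1 -q0; ring.
Qed.

(** Incidence with the two distinct projective points (q, 1) and (w, 0) leaves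
only a scalar factor free. *)
Lemma line_coords_join q w l : w != 0 ->
  line_coords (line q w) l <-> exists2 m : R, m != 0 & l = m *: join_coords q w.
Proof.
have [j0 j1 j2] := join_coordsE q w.
have jZ (m : R) k : (m *: join_coords q w) 0 k = m * join_coords q w 0 k.
  by rewrite mxE.
move=> w0; split=> [lE|[m m0 ->]].
  have [lq lw] := line_coords_incident lE.
  have r0 : rot90 w != 0 by exact: det2_neq0r (lt0r_neq0 (det2_rot90_gt0 w0)).
  have [|m mE] := @det2_eq0 _ _ (\row_j (if j == 0 then l 0 0 else l 0 1)) r0.
    by rewrite /det2 !mxE /=; rewrite -[RHS]oppr0 -lw; ring.
  have lm : l = m *: join_coords q w.
    have l0 := congr1 (fun u : 'rV[R]_2 => u 0 0) mE.
    have l1 := congr1 (fun u : 'rV[R]_2 => u 0 1) mE.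
    move: l0 l1; rewrite !mxE /= => l0 l1.
    apply: rV3P; rewrite jZ ?j0 ?j1 ?j2 //.
    have -> : l 0 2 = - (l 0 0 * q 0 0 + l 0 1 * q 0 1).
      by apply/eqP; rewrite -addr_eq0 addrC; apply/eqP.
    by rewrite l0 l1 /det2; ring.
  exists m => //; case: lE => + _; apply: contraNneq => m0.
  by rewrite lm m0 scale0r.
split.
  rewrite scaler_eq0 (negbTE m0) /=; apply: contraNneq w0 => jj.
  move: j0 j1; rewrite jj !mxE => w1 w0.
  by apply/eqP/rV2P; rewrite mxE //; apply/oppr_inj; rewrite -w1 oppr0.
apply/seteqP; split=> z /=.
  move=> /(line_det2 _ _ w0) zE; apply/incidenceE; rewrite !jZ j0 j1 j2.
  rewrite -(mulr0 m) -zE /det2 !mxE; ring.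
move=> /incidenceE; rewrite !jZ j0 j1 j2 => zE; apply/line_det2 => //.
apply: (mulfI m0); rewrite mulr0 -zE /det2 !mxE; ring.
Qed.

(** The envelope of lines that turn about q with nonzero speed is q. The given
coordinates l have the form m(t) join_coords q (w t), but differentiating this
product would require m to be differentiable; the derivatives of l are extracted
instead from the two incidence identities, in which m does not occur. *)
Lemma cross_line_coords q (A : 'M[R]_2) (v : R -> 'rV[R]_2)
    (l : R -> 'rV[R]_3) (s : R) :
  det2 (row 0 A) (row 1 A) != 0 ->
  derivable v s 1 -> free [:: v s; derive1 v s] -> derivable l s 1 ->
  (\forall t \near s, line_coords (line q (v t *m A)) (l t)) ->
  <[cross (l s) (derive1 l s)]>%VS = proj_point q.
Proof.
move=> A0 dv; rewrite free_det2 => v0 dl nl.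
pose w t := v t *m A; pose dw := derive1 v s *m A.
have w0 : det2 (w s) dw != 0 by rewrite det2_mulmx mulf_neq0.
have dlk k := is_derive_coord k dl.
have dwk k : is_derive s 1 (fun t => w t 0 k) (dw 0 k).
  rewrite (_ : (fun _ => _) = fun t => v t 0 0 * A 0 k + v t 0 1 * A 1 k).
    have H := is_derive_mul2 (is_derive_coord 0 dv) (is_derive_cst (A 0 k) s 1)
      (is_derive_coord 1 dv) (is_derive_cst (A 1 k) s 1).
    by apply: is_derive_eq H _; rewrite !mulr0 !addr0 mulmx2E.
  by apply/funext => t; rewrite /w mulmx2E.
have E1 : derive1 l s 0 0 * q 0 0 + derive1 l s 0 1 * q 0 1 +
    derive1 l s 0 2 = 0.
  have dF := is_deriveD (is_derive_mul2 (dlk 0) (is_derive_cst (q 0 0) s 1)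
    (dlk 1) (is_derive_cst (q 0 1) s 1)) (dlk 2).
  have := near0_derive dF; rewrite !mulr0 !addr0; apply.
  by apply: filterS nl => t /line_coords_incident[].
have E2 : derive1 l s 0 0 * w s 0 0 + l s 0 0 * dw 0 0 +
    (derive1 l s 0 1 * w s 0 1 + l s 0 1 * dw 0 1) = 0.
  apply: near0_derive (is_derive_mul2 (dlk 0) (dwk 0) (dlk 1) (dwk 1)) _.
  by apply: filterS nl => t /line_coords_incident[].
have ls := nbhs_singleton nl; have [E0 _] := line_coords_incident ls.
have [m m0 lm] := (line_coords_join _ _ (det2_neq0l w0)).1 ls.
have [j0 j1 j2] := join_coordsE q (w s).
have lk k : l s 0 k = m * join_coords q (w s) 0 k by rewrite lm mxE.
pose d := l s 0 0 * derive1 l s 0 1 - l s 0 1 * derive1 l s 0 0.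
(* d is the last coordinate of the cross product; it is proportional to the
   angular speed of the line, which the independence of v and v' keeps nonzero. *)
have dE : d = m ^+ 2 * det2 (w s) dw.
  transitivity
    (- m * (derive1 l s 0 0 * w s 0 0 + derive1 l s 0 1 * w s 0 1)).
    by rewrite /d !lk j0 j1; ring.
  move: E2; rewrite addrACA => /eqP; rewrite addr_eq0 => /eqP ->.
  by rewrite !lk j0 j1 /det2; ring.
have d0 : d != 0 by rewrite dE mulf_neq0 // expf_neq0.
have -> : cross (l s) (derive1 l s) = d *: Defs.hom q.
  have [c0 c1 c2] := crossE (l s) (derive1 l s).
  have [h0 h1 h2] := homE q; move: E0 E1.
  rewrite ![_ + _ 0 2]addrC => /eqP + /eqP.
  rewrite !addr_eq0 => /eqP E0 /eqP E1.
  by apply: rV3P; rewrite [RHS]mxE ?c0 ?c1 ?c2 ?h0 ?h1 ?h2 ?E0 ?E1 /d; ring.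
apply/vspaceP => x; apply/vlineP/vlineP => -[c ->].
  by exists (c * d); rewrite scalerA.
by exists (c / d); rewrite scalerA divfK.
Qed.
End Envelope.

(** * The piece of the transform *)

Section Piece.
Context {R : realType} {n : nat} (P : 'Z_(2 * n) -> 'rV[R]_2) (HP : cppos P).

Lemma ART_piece_sub p i T : corner_map P i T ->
  ART_piece P p i (i + 1) `<=` [set proj_point (T p)].
Proof.
move=> cT q [v [l [s [[dv fv] dl nl ->]]]]; have [[A [b TE]] _] := cT.
apply: (cross_line_coords (corner_map_det_neq0 HP cT TE) dv fv dl).
by apply: filterS nl => t [ct lt]; rewrite -(reflected_line_cell HP cT TE ct).
Qed.

(** Rotating a line of the cell about p along v + t rot90 v gives a regular
parametrization that stays in the cell near t = 0, with coordinates of the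
reflected lines that are affine in t. *)
Lemma ART_piece_nonempty p i T : corner_map P i T ->
  cell P p i (i + 1) !=set0 -> ART_piece P p i (i + 1) !=set0.
Proof.
move=> cT [_ [[/= v v0 <-] cv]]; have [[A [b TE]] _] := cT.
have A0 := corner_map_det_neq0 HP cT TE.
have ij : i != i + 1 by rewrite eq_sym succ_neq.
have cell0 : cell P p i (i + 1) (line p v) by split=> //; exists v.
pose w := rot90 v; pose V (t : R) : 'rV[R]_2 := v + t *: w.
pose l (t : R) := join_coords (T p) (V t *m A).
have dV : is_derive (0 : R) 1 V w := is_derive_affine v w 0.
have dl : derivable l 0 1.
  have -> : l = fun t =>
      join_coords (T p) (v *m A) + t *: join_coords (T p) (w *m A).
    by apply/funext => t; rewrite /l mulmxDl -scalemxAl join_coords_affine.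
  exact: (@ex_derive _ _ _ _ _ _ _ (is_derive_affine _ _ 0)).
pose q := cross (l 0) (derive1 l 0); exists <[q]>%VS, V, l, 0; split=> //.
  split=> //; rewrite derive1E derive_val free_det2 /V scale0r addr0.
  exact: lt0r_neq0 (det2_rot90_gt0 v0).
apply: filterS (cell_open HP w ij cell0) => t ct; split=> //.
rewrite (reflected_line_cell HP cT TE ct); apply/line_coords_join; last first.
  by exists 1; rewrite ?oner_neq0 ?scale1r.
apply: (@det2_neq0l _ _ (w *m A)); rewrite det2_mulmx mulf_neq0 //.
rewrite det2C /V det2D det2Z det2uu mulr0 addr0 -det2C.
exact: lt0r_neq0 (det2_rot90_gt0 v0).
Qed.
End Piece.

Theorem proposition6p7 (R : realType) (n : nat)
    (P : 'Z_(2 * n) -> 'rV[R]_2) (p : 'rV[R]_2) (i : 'Z_(2 * n))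
    (HP : cppos P) (Hp : interior (region P) p)
    (Hcell : cell P p i (i + 1) !=set0) :
  (exists! T : 'rV[R]_2 -> 'rV[R]_2, corner_map P i T) /\
  (forall T : 'rV[R]_2 -> 'rV[R]_2, corner_map P i T ->
    (forall L : set 'rV[R]_2, cell P p i (i + 1) L ->
       reflected_line P L (T p)) /\
    ART_piece P p i (i + 1) = [set proj_point (T p)]).
Proof.
split; first exact: corner_map_exists_unique.
move=> T cT; split=> [L cL|].
  have [[v _ LE] _] := cL; have [[A [b TE]] _] := cT.
  rewrite -LE in cL *; rewrite (reflected_line_cell HP cT TE cL).
  by exists 0; rewrite ?scale0r ?addr0.
have sub := ART_piece_sub HP (p := p) cT.
apply/seteqP; split=> // _ ->.
by have [q Aq] := ART_piece_nonempty HP cT Hcell; rewrite -(sub q Aq).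
Qed.
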